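(* Let $R$ be a ring, let $M$ be a faithfully projective right $R$-module, and let $E:=\operatorname{End}_R(M)$. If $E_E$ has finite length (i.e., $E$ is a right Artinian ring), then $M$ has finite length. Moreover, there exist natural numbers $k$, $n_1,\ldots,n_k$ and local (projective and strongly indecomposable) submodules $M_1,\ldots,M_k$ of $M$ such that $M\cong M_1^{n_1}\oplus\cdots\oplus M_k^{n_k}$. In fact, there exist local idempotents $e_1,\ldots,e_k$ of $R$ such that $M\cong (e_1R)^{n_1}\oplus\cdots\oplus(e_kR)^{n_k}$. In particular, these decompositions of $M$ are unique (in the Krull-Schmidt sense: the list of indecomposable summands, counted with multiplicity, is unique up to order and isomorphism).
   Context: Rings are unital with $1\neq 0$; modules are right unital modules. A right $R$-module $M$ is faithfully projective if the functor $\operatorname{Hom}_R(M,-)$ is faithfully exact, i.e., a sequence $A\to B\to C$ of right $R$-modules is exact if and only if the induced sequence $\operatorname{Hom}_R(M,A)\to\operatorname{Hom}_R(M,B)\to\operatorname{Hom}_R(M,C)$ is exact; equivalently, $M$ is projective and $\operatorname{Hom}_R(M,A)\neq 0$ for every nonzero right $R$-module $A$. A module is local if it has a unique maximal submodule and this submodule contains every proper submodule. A module is strongly indecomposable if its endomorphism ring is a local ring. An idempotent $e\in R$ is local if $eR$ is a local right $R$-module (equivalently, $eRe$ is a local ring). $E_E$ denotes $E$ as a right module over itself. *)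

(* Defs.v *)
From HB Require Import structures.
From mathcomp Require Import all_boot all_algebra.
From mathcomp Require Import boolp.

Set Implicit Arguments.
Unset Strict Implicit.
Unset Printing Implicit Defensive.

Import GRing.Theory.
Local Open Scope ring_scope.

(* Right R-modules are left modules over the converse ring R^c.  All the
   module-theoretic notions below are stated for [lmodType S] and used with
   [S := R^c]. *)
Notation rmodType R := (lmodType R^c).

(* R_R, i.e., R as a right module over itself: [a *: x] is the product [x * a]
   of R, since the scaling of R^c on (R^c)^o is the product of R^c. *)
Notation rreg R := ((R^c)^o).

(* Submodules are the library's [submodClosed], i.e., boolean predicates; under
   the classical axioms of boolp every Prop-valued predicate has a boolean
   counterpart, so that these are all the submodules. *)

Section Subtype.
Variables (S : pzRingType) (M : lmodType S) (N : submodClosed M).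

Record submod := Submod { submod_val :> M; _ : submod_val \in N }.

HB.instance Definition _ := [isSub for submod_val].
HB.instance Definition _ := [Choice of submod by <:].
HB.instance Definition _ := [SubChoice_isSubLmodule of submod by <:].

End Subtype.

Section EndomorphismRing.
Variables (S : pzRingType) (M : lmodType S).

Definition endo := {linear M -> M}.

HB.instance Definition _ := gen_eqMixin endo.
HB.instance Definition _ := gen_choiceMixin endo.

Fact endo_ext (f g : endo) : (forall x, f x = g x) -> f = g.
Proof.
case: f g => [f cf] [g cg] /= /funext fg; case: _ / fg cg => cg.
case: cf cg => [[fD] [fZ]] [[gD] [gZ]].
by rewrite (Prop_irrelevance fD gD) (Prop_irrelevance fZ gZ).
Qed.

Definition endo_zero : endo := \0.
Definition endo_opp (f : endo) : endo := \- f.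
Definition endo_add (f g : endo) : endo := f \+ g.
Definition endo_one : endo := idfun.
Definition endo_mul (f g : endo) : endo := f \o g.

Fact endo_addA : associative endo_add.
Proof. by move=> f g h; apply: endo_ext => x /=; rewrite addrA. Qed.
Fact endo_addC : commutative endo_add.
Proof. by move=> f g; apply: endo_ext => x /=; rewrite addrC. Qed.
Fact endo_add0 : left_id endo_zero endo_add.
Proof. by move=> f; apply: endo_ext => x /=; rewrite add0r. Qed.
Fact endo_addN : left_inverse endo_zero endo_opp endo_add.
Proof. by move=> f; apply: endo_ext => x /=; rewrite addNr. Qed.
Fact endo_mulA : associative endo_mul.
Proof. by move=> f g h; apply: endo_ext. Qed.
Fact endo_mul1 : left_id endo_one endo_mul.
Proof. by move=> f; apply: endo_ext. Qed.
Fact endo_mulr1 : right_id endo_one endo_mul.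
Proof. by move=> f; apply: endo_ext. Qed.
Fact endo_mulDl : left_distributive endo_mul endo_add.
Proof. by move=> f g h; apply: endo_ext. Qed.
Fact endo_mulDr : right_distributive endo_mul endo_add.
Proof. by move=> f g h; apply: endo_ext => x /=; rewrite linearD. Qed.

HB.instance Definition _ := GRing.isZmodule.Build endo
  endo_addA endo_addC endo_add0 endo_addN.
HB.instance Definition _ := GRing.Zmodule_isPzRing.Build endo
  endo_mulA endo_mul1 endo_mulr1 endo_mulDl endo_mulDr.

End EndomorphismRing.

Section DirectSum.
Variables (S : pzRingType) (I : finType) (A : I -> lmodType S).

(* A finite direct sum is the product, with pointwise operations. *)
Definition dsum := {dffun forall i : I, A i}.

HB.instance Definition _ := Choice.on dsum.

Definition dsum_zero : dsum := [ffun i => 0].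
Definition dsum_opp (f : dsum) : dsum := [ffun i => - f i].
Definition dsum_add (f g : dsum) : dsum := [ffun i => f i + g i].
Definition dsum_scale (a : S) (f : dsum) : dsum := [ffun i => a *: f i].

Fact dsum_addA : associative dsum_add.
Proof. by move=> f g h; apply/ffunP=> i; rewrite !ffunE addrA. Qed.
Fact dsum_addC : commutative dsum_add.
Proof. by move=> f g; apply/ffunP=> i; rewrite !ffunE addrC. Qed.
Fact dsum_add0 : left_id dsum_zero dsum_add.
Proof. by move=> f; apply/ffunP=> i; rewrite !ffunE add0r. Qed.
Fact dsum_addN : left_inverse dsum_zero dsum_opp dsum_add.
Proof. by move=> f; apply/ffunP=> i; rewrite !ffunE addNr. Qed.

HB.instance Definition _ := GRing.isZmodule.Build dsum
  dsum_addA dsum_addC dsum_add0 dsum_addN.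

Fact dsum_scaleA a b f : dsum_scale a (dsum_scale b f) = dsum_scale (a * b) f.
Proof. by apply/ffunP=> i; rewrite !ffunE scalerA. Qed.
Fact dsum_scale1 : left_id 1 dsum_scale.
Proof. by move=> f; apply/ffunP=> i; rewrite !ffunE scale1r. Qed.
Fact dsum_scaleDr : right_distributive dsum_scale +%R.
Proof. by move=> a f g; apply/ffunP=> i; rewrite !ffunE scalerDr. Qed.
Fact dsum_scaleDl f : {morph dsum_scale^~ f : a b / a + b}.
Proof. by move=> a b; apply/ffunP=> i; rewrite !ffunE scalerDl. Qed.

HB.instance Definition _ := GRing.Zmodule_isLmodule.Build S dsum
  dsum_scaleA dsum_scale1 dsum_scaleDr dsum_scaleDl.

End DirectSum.

Section ModuleNotions.
Variable S : pzRingType.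
Implicit Types M A B C : lmodType S.

Definition isomorphic A B : Prop := exists f : {linear A -> B}, bijective f.

Definition exact A B C (f : {linear A -> B}) (g : {linear B -> C}) : Prop :=
  forall b, g b = 0 <-> exists a, f a = b.

(* Exactness of Hom(M, A) -> Hom(M, B) -> Hom(M, C). *)
Definition Hom_exact M A B C (f : {linear A -> B}) (g : {linear B -> C}) :
    Prop :=
  forall h : {linear M -> B},
    (forall x, g (h x) = 0) <->
    exists k : {linear M -> A}, forall x, f (k x) = h x.

Definition faithfully_projective M : Prop :=
  forall A B C (f : {linear A -> B}) (g : {linear B -> C}),
    exact f g <-> Hom_exact M f g.

Definition projective M : Prop :=
  forall A B (g : {linear A -> B}) (h : {linear M -> B}),
    (forall b, exists a, g a = b) ->
    exists k : {linear M -> A}, forall x, g (k x) = h x.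

(* N is a maximal proper submodule of K, i.e., K / N is simple. *)
Definition maximal_in M (K : {pred M}) (N : submodClosed M) : Prop :=
  [/\ {subset N <= K}, ~ {subset K <= N}
    & forall L : submodClosed M, {subset N <= L} -> {subset L <= K} ->
        L =i N \/ L =i K].

Definition maximal_submod M (N : submodClosed M) : Prop := maximal_in predT N.

(* Existence of a composition series. *)
Definition finite_length M : Prop :=
  exists (n : nat) (N : nat -> submodClosed M),
    [/\ N 0%N =i pred1 0, N n =i predT
      & forall i, (i < n)%N -> maximal_in (N i.+1) (N i)].

Definition local_module M : Prop :=
  exists N : submodClosed M,
    [/\ maximal_submod N,
        forall N' : submodClosed M, maximal_submod N' -> N' =i N
      & forall L : submodClosed M, ~ (L =i predT) -> {subset L <= N}].

Definition indecomposable M : Prop :=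
  (exists x : M, x != 0) /\
  forall N L : submodClosed M,
    (forall x, x \in N -> x \in L -> x = 0) ->
    (forall x, exists y z, [/\ y \in N, z \in L & x = y + z]) ->
    N =i pred1 0 \/ L =i pred1 0.

End ModuleNotions.

(* A unique maximal right ideal. *)
Definition local_ring (E : pzRingType) : Prop :=
  exists J : submodClosed (rreg E),
    maximal_submod J /\
    forall J' : submodClosed (rreg E), maximal_submod J' -> J' =i J.

Definition strongly_indecomposable (S : pzRingType) (M : lmodType S) : Prop :=
  local_ring (endo M).

Section PrincipalRightIdeal.
Variables (R : pzRingType) (e : R).

(* eR; [e * r] is the product of R, not of R^c. *)
Definition in_pright : {pred rreg R} := fun x => `[< exists r : R, x = e * r >].

Fact in_pright_submod_closed : submod_closed in_pright.
Proof.
split; first by apply/asboolP; exists 0; rewrite mulr0.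
move=> a x y /asboolP[r ->] /asboolP[s ->]; apply/asboolP.
by exists (r * a + s); rewrite mulrDr mulrA.
Qed.

HB.instance Definition _ :=
  GRing.isSubmodClosed.Build R^c (rreg R) in_pright in_pright_submod_closed.

Definition pright : submodClosed (rreg R) := in_pright.

Definition local_idempotent : Prop :=
  e * e = e /\ local_module (submod pright).

End PrincipalRightIdeal.

(* Main.v *)
(* Since Hom(M, -) is faithfully exact, K |-> Hom(M, K) is strictly monotone from
   the submodules of M to the right ideals of E, so M has finite length.  By
   Fitting's lemma, primitive idempotents of E then have local corner rings, and
   1 is a sum of orthogonal primitive idempotents, whose images are projective
   with local endomorphism rings.  Such an image P has a maximal submodule, which
   by projectivity contains every proper submodule, so P is cyclic, and hence
   isomorphic to some e R.  Uniqueness is the Krull-Schmidt exchange argument,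
   carried out on complete families of orthogonal idempotents of E. *)
From HB Require Import structures.
From mathcomp Require Import all_boot all_algebra.
From mathcomp Require Import boolp zify.
Require Import Defs.

Set Implicit Arguments.
Unset Strict Implicit.
Unset Printing Implicit Defensive.

Import GRing.Theory.

(** * Chains of submodules, composition series and chain conditions *)

Section Submodules.
Local Open Scope ring_scope.
Variables (S : pzRingType) (M : lmodType S).
Implicit Types K L N X : submodClosed M.

Definition submodP (P : M -> Prop) :=
  P 0 /\ forall a x y, P x -> P y -> P (a *: x + y).

Lemma submodP_closed (P : M -> Prop) :
  submodP P -> submod_closed (fun x => `[< P x >] : bool).
Proof.
case=> P0 PD; split; first by apply/asboolP.
by move=> a x y /asboolP Px /asboolP Py; apply/asboolP/PD.
Qed.

Definition mksub (P : M -> Prop) (hP : submodP P) : submodClosed M :=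
  HB.pack (fun x => `[< P x >] : bool)
    (GRing.isSubmodClosed.Build S M _ (submodP_closed hP)).

Lemma mksubP (P : M -> Prop) (hP : submodP P) x :
  reflect (P x) (x \in mksub hP).
Proof. exact: asboolP. Qed.

Lemma submod_lin K a x y : x \in K -> y \in K -> a *: x + y \in K.
Proof. by move=> xK yK; rewrite rpredD ?rpredZ. Qed.

Lemma submodB K x y : x \in K -> y \in K -> x - y \in K.
Proof. by move=> xK yK; rewrite addrC -scaleN1r submod_lin. Qed.

Fact sub0_subproof : submodP (fun x : M => x = 0).
Proof. by split=> // a x y -> ->; rewrite scaler0 addr0. Qed.
Definition sub0 := mksub sub0_subproof.

Fact subT_subproof : submodP (fun x : M => True).
Proof. by []. Qed.
Definition subT := mksub subT_subproof.

Fact subI_subproof K L : submodP (fun x => x \in K /\ x \in L).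
Proof.
split; first by rewrite !rpred0.
by move=> a x y [? ?] [? ?]; rewrite !submod_lin.
Qed.
Definition subI K L := mksub (subI_subproof K L).

Fact subD_subproof K L :
  submodP (fun x => exists y z, [/\ y \in K, z \in L & x = y + z]).
Proof.
split; first by exists 0, 0; rewrite !rpred0 addr0.
move=> a _ _ [y [z [yK zL ->]]] [y' [z' [yK' zL' ->]]].
by exists (a *: y + y'), (a *: z + z'); rewrite !submod_lin // scalerDr addrACA.
Qed.
Definition subD K L := mksub (subD_subproof K L).

(* Every strict chain of submodules of K has length at most n. *)
Fixpoint height_le (n : nat) K : Prop :=
  if n is n'.+1 then
    forall L, {subset L <= K} -> ~ {subset K <= L} -> height_le n' L
  else forall x, x \in K -> x = 0.

Lemma height_leW n K L : {subset L <= K} -> height_le n K -> height_le n L.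
Proof.
case: n => [|n] LK /= hK; first by move=> x /LK /hK.
by move=> X XL LX; apply: hK => [x /XL /LK //|KX]; apply: LX => x /LK /KX.
Qed.

Lemma height_leS n K : height_le n K -> height_le n.+1 K.
Proof.
elim: n K => [|n IH] K hK L LK KL.
  by case: KL => x /hK ->; rewrite rpred0.
by apply: IH; apply: hK.
Qed.

(* Second isomorphism theorem: L / (L :&: N) is isomorphic to K / N. *)
Lemma maximal_inI K N L :
  maximal_in K N -> {subset L <= K} -> ~ {subset L <= N} ->
  maximal_in L (subI L N).
Proof.
move=> [NK KN maxN] LK LN; split=> [x /mksubP[] //||X IX XL].
  by move=> h; apply: LN => x /h /mksubP[].
have NXN : {subset N <= subD X N}.
  by move=> x xN; apply/mksubP; exists 0, x; rewrite rpred0 add0r.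
have NXK : {subset subD X N <= K}.
  by move=> _ /mksubP[y [z [/XL /LK yK /NK zK ->]]]; rewrite rpredD.
case: (maxN _ NXN NXK) => eqN; [left|right] => x.
  apply/idP/idP=> [xX|/IX //]; apply/mksubP; split; first exact: XL.
  by rewrite -eqN; apply/mksubP; exists x, 0; rewrite rpred0 addr0.
apply/idP/idP=> [/XL //|xL].
have /mksubP[y [z [yX zN def_x]]] : x \in subD X N by rewrite eqN LK.
rewrite def_x rpredD //; apply: IX; apply/mksubP; split=> //.
have -> : z = x - y by rewrite def_x addrC addKr.
by apply: submodB => //; apply: XL.
Qed.

(** By induction on [n]. A proper submodule [L] of [K] either lies in [N], or meets [N] in a maximal
    submodule of [L]. In the second case the intersection is proper in [N]: otherwise [N] would lie
    in [L], and maximality would give [L = N] or [L = K]. *)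
Lemma height_le_maximal n K N :
  maximal_in K N -> height_le n N -> height_le n.+1 K.
Proof.
elim: n K N => [|n IH] K N mN hN L LK KL; have [NK KN maxN] := mN.
  have [LN|LN] := pselect {subset L <= N}; first by move=> x /LN /hN.
  have NL : {subset N <= L} by move=> x /hN ->; rewrite rpred0.
  have [eqL|eqL] := maxN L NL LK; first by case: LN => x; rewrite eqL.
  by case: KL => x; rewrite eqL.
have [LN|LN] := pselect {subset L <= N}; first exact: height_leW hN.
apply: (IH _ _ (maximal_inI mN LK LN)).
apply: hN => [x /mksubP[] //|NI].
have NL : {subset N <= L} by move=> x /NI /mksubP[].
have [eqL|eqL] := maxN L NL LK; first by case: LN => x; rewrite eqL.
by case: KL => x; rewrite eqL.
Qed.

Lemma finite_length_height : finite_length M -> exists n, height_le n subT.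
Proof.
case=> n [N [N0 Nn maxN]]; exists n.
have hN i : (i <= n)%N -> height_le i (N i).
  elim: i => [|i IH] ilen; first by move=> x; rewrite N0 => /eqP.
  by apply: height_le_maximal (maxN i ilen) _; apply: IH; apply: ltnW.
by apply: height_leW (hN n (leqnn n)) => x _; rewrite Nn.
Qed.

(** If the bound on the height of [K] can be lowered, induct. Otherwise some proper submodule [L] is
    as high as the bound permits, and a submodule strictly between [L] and [K] would produce too
    long a chain in [K]. *)
Lemma exists_maximal n K :
  height_le n.+1 K -> ~ (forall x, x \in K -> x = 0) ->
  exists N, maximal_in K N /\ height_le n N.
Proof.
elim: n => [|n IH] hK K0.
  exists sub0; have s0 : forall x, x \in sub0 -> x = 0 by move=> x /mksubP.
  split=> //; split=> [x /s0 ->|K00|L _ LK]; first exact: rpred0.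
    by apply: K0 => x /K00 /s0.
  have [KL|KL] := pselect {subset K <= L}.
    by right=> x; apply/idP/idP=> [/LK|/KL].
  by left=> x; apply/idP/idP=> [/(hK L LK KL) ->|/s0 ->]; rewrite rpred0.
have [hK'|] := pselect (height_le n.+1 K).
  by have [N [mN hN]] := IH hK' K0; exists N; split=> //; apply: height_leS.
move=> hK'.
have [L [LK KL hL]] :
    exists L, [/\ {subset L <= K}, ~ {subset K <= L} & ~ height_le n L].
  apply: contrapT => nex; apply: hK' => L LK KL.
  by apply: contrapT => hL; apply: nex; exists L.
exists L; split; last exact: hK.
split=> // X LX XK; have [KX|KX] := pselect {subset K <= X}.
  by right=> x; apply/idP/idP=> [/XK|/KX].
left=> x; apply/idP/idP=> [|/LX //]; move: x.
by apply: contrapT => XL; apply: hL; apply: (hK X XK KX L LX XL).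
Qed.

Lemma maximal_in_eqi K K' N N' :
  K =i K' -> N =i N' -> maximal_in K N -> maximal_in K' N'.
Proof.
move=> eK eN [NK KN maxN]; split.
- by move=> x; rewrite -eN -eK; apply: NK.
- by move=> h; apply: KN => x; rewrite eN eK; apply: h.
- move=> L NL LK; case: (maxN L) => [x|x|eL|eL].
  + by rewrite eN; apply: NL.
  + by rewrite eK; apply: LK.
  + by left=> x; rewrite eL eN.
  + by right=> x; rewrite eL eK.
Qed.

(** A composition series is built from the top: take a maximal submodule, whose height bound is
    smaller by one, and recurse. *)
Lemma height_finite_length n : height_le n subT -> finite_length M.
Proof.
suff comp K : height_le n K -> exists (m : nat) (N : nat -> submodClosed M),
    [/\ N 0%N =i pred1 0, N m =i K
      & forall i, (i < m)%N -> maximal_in (N i.+1) (N i)].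
  move=> /comp[m [N [N0 Nm maxN]]]; exists m, N; split=> // x.
  by rewrite Nm; apply/mksubP.
elim: n K => [|n IH] K hK.
  exists 0%N, (fun=> K); split=> // x.
  by apply/idP/eqP=> [/hK|->]; rewrite ?rpred0.
have [K0|K0] := pselect (forall x, x \in K -> x = 0).
  (* The zero submodule satisfies every height bound, so the induction hypothesis applies to [K]
     itself. *)
  by apply: IH; case: (n) => [//|m L LK []] x /K0 ->; rewrite rpred0.
have [N [mN /IH[m [C [C0 Cm maxC]]]]] := exists_maximal hK K0.
(* The series of [N] fills the indices up to [m], and [K] sits at [m.+1]. *)
exists m.+1, (fun i => if (i <= m)%N then C i else K); split=> //.
  by rewrite ltnn.
move=> i /=; rewrite ltnS => leim.
  have /predU1P[->|ltim] : (i == m) || (i < m)%N by rewrite -leq_eqVlt.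
  by rewrite /= ltnn leqnn; apply: maximal_in_eqi mN => // x; rewrite Cm.
by rewrite /= ltim ltnW //; apply: maxC.
Qed.

Lemma descending_stops n (D : nat -> submodClosed M) :
  height_le n (D 0%N) -> (forall i, {subset D i.+1 <= D i}) ->
  exists i, {subset D i <= D i.+1}.
Proof.
elim: n D => [|n IH] D hD decD.
  by exists 0%N => x /hD ->; rewrite rpred0.
have [D01|D01] := pselect {subset D 0%N <= D 1%N}; first by exists 0%N.
have [i Di] := IH (fun i => D i.+1) (hD _ (decD 0%N) D01) (fun i => decD i.+1).
by exists i.+1.
Qed.

Lemma ascending_stops n (D : nat -> submodClosed M) :
  height_le n subT -> (forall i, {subset D i <= D i.+1}) ->
  exists i, {subset D i.+1 <= D i}.
Proof.
move=> hT incD; apply: contrapT => nex.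
have strict i : ~ {subset D i.+1 <= D i} by move=> h; apply: nex; exists i.
(* The chain from [D 0] to [D m] is strict with [m] steps, so no height bound of [D m] is below [m];
   the index [n.+1] then contradicts [hT]. *)
have bound m k : height_le k (D m) -> (m <= k)%N.
  elim: k m => [|k IH] [|m] //= hD; last by apply: IH; apply: hD (strict m).
  by case: (strict m) => x /hD ->; rewrite rpred0.
suff: (n.+1 <= n)%N by rewrite ltnn.
by apply: bound; apply: height_leW hT => x _; apply/mksubP.
Qed.

End Submodules.
Arguments sub0 {S M}.
Arguments subT {S M}.

(** * Local and primitive idempotents of a ring, and the exchange property *)

Section Idempotents.
Local Open Scope ring_scope.
Variable E : pzRingType.
Implicit Types a b c x y z t u v : E.

(** [t] is the inverse of [x] in the corner ring [a E a], whose identity is [a]. *)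
Definition corner_unit a x :=
  exists t, [/\ a * t = t, t * a = t, t * x = a & x * t = a].

(** Locality of the corner ring in the form: of two elements with sum [a], one is a unit. *)
Definition local_idem a :=
  [/\ a * a = a, a <> 0 & forall x, a * x = x -> x * a = x ->
    corner_unit a x \/ corner_unit a (a - x)].

Definition primitive_idem a :=
  [/\ a * a = a, a <> 0 & forall x, x * x = x -> a * x = x -> x * a = x ->
    x = 0 \/ x = a].

(** Ring-theoretic form of Fitting's lemma: a power of [x] has a commuting generalized inverse. The
    exponent is [n.+1] because exponent 0 would make the condition trivial. *)
Definition strongly_pi_regular :=
  forall x, exists n y, x ^+ n.+1 * y = y * x ^+ n.+1 /\
    x ^+ n.+1 * y * x ^+ n.+1 = x ^+ n.+1.

(** The one-sided inverses may lie outside the corner; cut down to it they agree, as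
    [l * a = l * x * r = a * r]. *)
Lemma corner_unitLR a x l r :
  a * a = a -> a * x = x -> x * a = x -> l * x = a -> x * r = a ->
  corner_unit a x.
Proof.
move=> aa ax xa lx xr; have lr : l * a = a * r by rewrite -xr mulrA lx xr.
exists (l * a); split; last by rewrite lr mulrA xa.
- by rewrite lr mulrA aa.
- by rewrite -mulrA aa.
- by rewrite -mulrA ax.
Qed.

(** The product of a power of [x] with its generalized inverse is an idempotent of the corner, hence
    [0] or [a]. In the first case [x] is nilpotent and [a - x] is a unit; in the second [x] is a
    unit. *)
Lemma primitive_idem_local a :
  strongly_pi_regular -> primitive_idem a -> local_idem a.
Proof.
move=> spr [aa a0 prim]; split=> // x ax xa.
have [n [y [zy zyz]]] := spr x.
have az : a * x ^+ n.+1 = x ^+ n.+1 by rewrite exprS mulrA ax.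
have za : x ^+ n.+1 * a = x ^+ n.+1 by rewrite exprSr -mulrA xa.
have [||| p0|pa] := prim (x ^+ n.+1 * y).
- by rewrite mulrA zyz.
- by rewrite mulrA az.
- by rewrite zy -mulrA za.
- right; have z0 : x ^+ n.+1 = 0 by rewrite -zyz p0 mul0r.
  (* The geometric series inverts [1 - x] in [E], and [a - x] is the product of [1 - x] and [a]. *)
  pose s := \sum_(i < n.+1) x ^+ i.
  have sx : (1 - x) * s = 1.
    by rewrite -opprB mulNr -subrX1 z0 sub0r opprK.
  have xs : s * (1 - x) = 1.
    suff cs : GRing.comm (1 - x) s by rewrite -cs.
    apply: commr_sum => i _; apply: commrX.
    by apply: commr_sym; apply: commrB => //; apply: commr1.
  apply: (@corner_unitLR _ _ s s) => //.
  + by rewrite mulrBr aa ax.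
  + by rewrite mulrBl aa xa.
  + by rewrite -{1}xa -[X in X - _]mul1r -mulrBl mulrA xs mul1r.
  + by rewrite -{1}ax -[X in X - _]mulr1 -mulrBr -mulrA sx mulr1.
- left; apply: (@corner_unitLR _ _ (y * x ^+ n) (x ^+ n * y)) => //.
    by rewrite -mulrA -exprSr -zy.
  by rewrite mulrA -exprS.
Qed.

(** For idempotents this is the usual equivalence: it amounts to an isomorphism of the right ideals
    [a E] and [b E]. *)
Definition idem_iso a b := exists u v, u * v = a /\ v * u = b.

Lemma idem_iso_trans a b c : a * a = a -> c * c = c ->
  idem_iso a b -> idem_iso b c -> idem_iso a c.
Proof.
move=> aa cc [u [v [uv vu]]] [u' [v' [uv' vu']]].
exists (u * u'), (v' * v); split.
  by rewrite mulrA -(mulrA u) uv' -vu mulrA uv -mulrA uv aa.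
by rewrite mulrA -(mulrA v') vu -uv' mulrA vu' -mulrA vu' cc.
Qed.

(* The hypotheses say that a and b have the same image. *)
Lemma idem_iso_image a b : a * b = b -> b * a = a -> idem_iso a b.
Proof. by move=> ab ba; exists b, a. Qed.

(** The corner at [b] is carried to the corner at [a] by sending [w] to [u * w * v], and inverses
    come back by sending [t] to [v * t * u]. *)
Lemma idem_iso_local a b :
  b * b = b -> idem_iso a b -> local_idem a -> local_idem b.
Proof.
move=> bb [u [v [uv vu]]] [aa a0 loc].
have vau : v * a * u = b by rewrite -uv !mulrA vu -mulrA vu bb.
have ub : u * b = a * u by rewrite -vu mulrA uv.
have bv : b * v = v * a by rewrite -vu -mulrA uv.
have transfer w : b * w = w -> w * b = w -> corner_unit a (u * w * v) ->
    corner_unit b w.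
  move=> bw wb [t [At tA tx xt]].
  exists (v * t * u); split.
  - by rewrite !mulrA bv -(mulrA v) At.
  - by rewrite -mulrA ub mulrA -(mulrA v) tA.
  - by rewrite -vau -tx -!mulrA vu wb.
  - by rewrite -vau -xt !mulrA vu bw.
split=> // [b0|x bx xb].
  by apply: a0; rewrite -aa -uv mulrA -(mulrA u) vu b0 mulr0 mul0r.
have [||h|h] := loc (u * x * v).
- by rewrite !mulrA -ub -(mulrA u) bx.
- by rewrite -!mulrA -bv (mulrA x) xb.
- by left; apply: transfer.
right; apply: transfer; rewrite ?mulrBr ?mulrBl ?bx ?xb ?bb //.
by rewrite ub -mulrA uv aa.
Qed.

Lemma corner_unit_mulVl c x y :
  c * c = c -> c * x = x -> corner_unit c y -> corner_unit c (y * x) ->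
  x * c = x -> corner_unit c x.
Proof.
move=> cc cx [w [cw wc wy yw]] [r [cr rc rx xr]] xc.
apply: (@corner_unitLR _ _ (r * y) (r * y)) => //; first by rewrite -mulrA.
have: w * (y * x * r) * y = c by rewrite xr wc.
by rewrite !mulrA wy cx.
Qed.

(** If [t] inverts [x + y], then [t * x + t * y = c], so by locality [t * x] or [t * y] is a unit,
    and the unit [t] cancels. *)
Lemma local_idem_sum (I : Type) (s : seq I) (F : I -> E) c :
  local_idem c -> (forall i, c * F i = F i) -> (forall i, F i * c = F i) ->
  corner_unit c (\sum_(i <- s) F i) -> exists i, corner_unit c (F i).
Proof.
move=> [cc c0 loc] cF Fc; elim: s => [|i s IH].
  by rewrite big_nil => -[t [_ _]]; rewrite mulr0 => /esym.
rewrite big_cons; set x := F i; set y := \sum_(j <- s) F j.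
have cy : c * y = y by rewrite mulr_sumr; apply: eq_bigr.
have yc : y * c = y by rewrite mulr_suml; apply: eq_bigr.
case=> t [ct tc tu ut].
have ctu : corner_unit c t.
  by exists (x + y); rewrite mulrDr mulrDl cF Fc cy yc.
have txy : c - t * x = t * y by rewrite -tu mulrDr addrC addKr.
have [||h|h] := loc (t * x).
- by rewrite mulrA ct.
- by rewrite -mulrA Fc.
- by exists i; apply: corner_unit_mulVl cc (cF i) ctu h (Fc i).
- by apply: IH; rewrite txy in h; apply: corner_unit_mulVl cc cy ctu h yc.
Qed.

Definition complete_idem (I : finType) (c : I -> E) :=
  [/\ forall i, c i * c i = c i, forall i j, i != j -> c i * c j = 0
    & \sum_i c i = 1].

(* If [c i b c i] is a unit of the corner at [c i], with inverse t, then b t is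
   an idempotent with the same kernel as [c i], and with image that of b since b
   is primitive; it can thus replace [c i] in the complete family. *)
Lemma exchange (I J : finType) (c : I -> E) (b : J -> E) i0 :
  complete_idem c -> (forall i, local_idem (c i)) ->
  complete_idem b -> (forall j, primitive_idem (b j)) ->
  exists j (c' : I -> E),
    [/\ complete_idem c', forall i, idem_iso (c i) (c' i),
        c' i0 * b j = b j /\ b j * c' i0 = c' i0
      & forall i, i != i0 -> c' i * c i = c i /\ c i * c' i = c' i].
Proof.
move=> [cc co c1] cloc [bb bo b1] bprim.
set e := c i0; have ee : e * e = e := cc i0.
have [_ e0 _] := cloc i0.
(* Expanding 1 as the sum of the [b j] writes [e] as the sum of the [e * b j * e], one of which must
   be a unit of the local corner. *)
have [j [t [et te tx xt]]] : exists j, corner_unit e (e * b j * e).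
  apply: (local_idem_sum (s := index_enum J) (cloc i0)) => [j|j|].
  - by rewrite !mulrA ee.
  - by rewrite -mulrA ee.
  - by rewrite -mulr_suml -mulr_sumr b1 mulr1 ee; exists e; split.
have {tx}tbe : t * b j * e = e by rewrite -[RHS]tx !mulrA te.
have {xt}ebt : e * b j * t = e by rewrite -[RHS]xt -[in RHS]mulrA et.
have tbt : t * b j * t = t by rewrite -{2}et mulrA tbe et.
pose f := b j * t.
have bf : b j * f = f by rewrite mulrA bb.
have ef : e * f = e by rewrite mulrA.
have fe : f * e = f by rewrite -mulrA te.
have ff : f * f = f by rewrite /f mulrA -(mulrA (b j)) -mulrA tbt.
have fb : f * b j = b j.
  (* [f * b j] is an idempotent of the corner at [b j]. It is nonzero, since otherwise [t], and with
     it [e], would vanish. *)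
  have [_ _ bp] := bprim j; have [|||p0|//] := bp (f * b j).
  - by rewrite mulrA -(mulrA f) bf ff.
  - by rewrite mulrA bf.
  - by rewrite -mulrA bb.
  - case: e0; have: t * (f * b j) * t = 0 by rewrite p0 mulr0 mul0r.
    rewrite /f !mulrA tbt tbt => t0.
    by rewrite -/e -ebt t0 mulr0.
(* The factor [1 - f] restores orthogonality to [f] on the other side, [f * c i = 0] being
   automatic. The sum remains 1 because [e * f = e]. *)
pose c' i := if i == i0 then f else c i * (1 - f).
have fc i : i != i0 -> f * c i = 0.
  by move=> ii; rewrite -fe -mulrA co ?mulr0 // eq_sym.
have f'f : (1 - f) * f = 0 by rewrite mulrBl mul1r ff subrr.
have f'c i : i != i0 -> (1 - f) * c i = c i.
  by move=> ii; rewrite mulrBl mul1r fc // subr0.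
have same i : i != i0 -> c' i * c i = c i /\ c i * c' i = c' i.
  move=> ii; rewrite /c' (negPf ii) mulrA cc; split=> //.
  by rewrite -mulrA f'c // cc.
exists j, c'; split=> //.
- split.
  + move=> i; have [->|ii] := eqVneq i i0; first by rewrite /c' eqxx.
    have [h1 h2] := same i ii.
    by rewrite -{2}h2 mulrA h1 h2.
  + move=> i k ik; rewrite /c'.
    have [ii|ii] := eqVneq i i0; have [kk|kk] := eqVneq k i0.
    * by rewrite ii kk eqxx in ik.
    * by rewrite mulrA fc // mul0r.
    * by rewrite -mulrA f'f mulr0.
    * by rewrite mulrA -(mulrA (c i)) f'c // co // mul0r.
  + rewrite (bigD1 i0) //= /c' eqxx.
    under eq_bigr => i /negPf -> do [].
    rewrite -mulr_suml.
    have -> : \sum_(i | i != i0) c i = 1 - e.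
      by rewrite -c1 [in RHS](bigD1 i0) //= -/e (addrC e) addrK.
    rewrite mulrBl mul1r mulrBr mulr1 ef subrr subr0.
    by rewrite addrC subrK.
- move=> i; have [->|ii] := eqVneq i i0.
    by exists e, f; rewrite /c' eqxx.
  by have [h1 h2] := same i ii; apply: idem_iso_image.
- by rewrite /c' eqxx.
Qed.

(** The indices of [I] are exchanged one at a time. Each exchange preserves the images of the other
    members of the family, so partners found earlier remain valid. *)
Lemma exchange_injection (I J : finType) (a : I -> E) (b : J -> E) :
  complete_idem a -> (forall i, local_idem (a i)) ->
  complete_idem b -> (forall j, primitive_idem (b j)) ->
  exists s : I -> J, injective s /\ forall i, idem_iso (a i) (b (s i)).
Proof.
move=> ca la cb pb; have [aa _ _] := ca; have [bb _ _] := cb.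
have [i00|I0] := pselect (exists i : I, True); last first.
  have sF (i : I) : False by apply: I0; exists i.
  by exists (fun i => False_rect J (sF i)); split=> i; case: (sF i).
(* The partner map takes values in [option J], with [None] as the default before an index is
   processed. *)
have step (r : seq I) : exists (c : I -> E) (s : I -> option J),
    [/\ complete_idem c, forall i, idem_iso (a i) (c i)
      & forall i, i \in r -> exists j, [/\ s i = Some j,
          c i * b j = b j & b j * c i = c i]].
  elim: r => [|i0 r [c [s [cc ac hs]]]].
    exists a, (fun=> None); split=> // i.
    by apply: idem_iso_image; apply: aa.
  have lc i : local_idem (c i).
    by have [ccc _ _] := cc; apply: idem_iso_local (ac i) (la i).
  have [j [c' [cc' isoc' [c'b bc'] same]]] := exchange i0 cc lc cb pb.
  exists c', (fun i => if i == i0 then Some j else s i); split=> //.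
    move=> i; have [c'c' _ _] := cc'.
    by apply: idem_iso_trans (ac i) (isoc' i).
  move=> i; rewrite inE; have [-> _|ii /= /hs[k [-> cb' bc]]] := eqVneq i i0.
    by exists j.
  have [h1 h2] := same i ii; exists k; split=> //.
    by rewrite -cb' mulrA h1.
  by rewrite -h2 mulrA bc.
have [c [s [cc ac hs]]] := step (enum I).
have {}hs i : {j | [/\ s i = Some j, c i * b j = b j & b j * c i = c i]}.
  by apply/cid/hs; rewrite mem_enum.
exists (fun i => projT1 (hs i)); split.
  (* Distinct indices sharing a partner [j] would give [b j = c i * c k * b j = 0]. *)
  move=> i k; case: (hs i) => /= j [_ cij _]; case: (hs k) => /= j' [_ ckj _].
  move=> jj; rewrite -jj in ckj; apply: contrapT => /eqP ik.
  have [_ b0 _] := pb j; apply: b0.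
  have [_ co _] := cc.
  by rewrite -cij -ckj mulrA co // mul0r.
move=> i; case: (hs i) => /= j [_ cb' bc].
by apply: idem_iso_trans (ac i) (idem_iso_image cb' bc).
Qed.

(** Exchange works in both directions; an injection between finite types is bijective once there is
    an injection back. *)
Lemma krull_schmidt_idem (I J : finType) (a : I -> E) (b : J -> E) :
  strongly_pi_regular ->
  complete_idem a -> (forall i, primitive_idem (a i)) ->
  complete_idem b -> (forall j, primitive_idem (b j)) ->
  exists s : I -> J, bijective s /\ forall i, idem_iso (a i) (b (s i)).
Proof.
move=> spr ca pa cb pb.
have loc x : primitive_idem x -> local_idem x by apply: primitive_idem_local.
have [s [s_inj iso_s]] := exchange_injection ca (fun i => loc _ (pa i)) cb pb.
have [r [r_inj _]] := exchange_injection cb (fun j => loc _ (pb j)) ca pa.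
by exists s; split=> //; apply: inj_card_bij (leq_card _ r_inj).
Qed.

End Idempotents.

(** * Images, preimages, transfer of heights and Fitting's lemma *)

Section LinearMaps.
Local Open Scope ring_scope.
Variable S : pzRingType.
Implicit Types A B C M : lmodType S.

Definition mklin A B (f : A -> B) (lin_f : linear f) : {linear A -> B} :=
  HB.pack f (GRing.isLinear.Build S A B *:%R f lin_f).

Fact image_subproof A B (f : {linear A -> B}) :
  submodP (fun y => exists x, y = f x).
Proof.
split; first by exists 0; rewrite linear0.
by move=> a _ _ [x ->] [x' ->]; exists (a *: x + x'); rewrite linearP.
Qed.
Definition image A B (f : {linear A -> B}) := mksub (image_subproof f).

Fact preimage_subproof A B (f : {linear A -> B}) (K : submodClosed B) :
  submodP (fun x => f x \in K).
Proof.
split; first by rewrite linear0 rpred0.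
by move=> a x y fx fy; rewrite linearP submod_lin.
Qed.
Definition preimage A B (f : {linear A -> B}) (K : submodClosed B) :=
  mksub (preimage_subproof f K).

Fact image_sub_subproof A B (f : {linear A -> B}) (K : submodClosed A) :
  submodP (fun y => exists2 x, x \in K & y = f x).
Proof.
split; first by exists 0; rewrite ?rpred0 ?linear0.
move=> a _ _ [x xK ->] [x' xK' ->]; exists (a *: x + x'); last by rewrite linearP.
exact: submod_lin.
Qed.
Definition image_sub A B (f : {linear A -> B}) (K : submodClosed A) :=
  mksub (image_sub_subproof f K).

Fact submod_mk_linear A M (K : submodClosed M) (f : {linear A -> M})
  (fK : forall x, f x \in K) : linear (fun x => Submod (fK x)).
Proof. by move=> a x y; apply: val_inj; rewrite /= linearP. Qed.
Definition corestrict A M (K : submodClosed M) (f : {linear A -> M})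
  (fK : forall x, f x \in K) : {linear A -> submod K} :=
  mklin (submod_mk_linear fK).

Lemma submod_val_in M (K : submodClosed M) (x : submod K) : val x \in K.
Proof. by case: x. Qed.

Definition incl M (K : submodClosed M) : {linear submod K -> M} := val.

Lemma isomorphicP A B : isomorphic A B ->
  exists (f : {linear A -> B}) (g : {linear B -> A}), cancel f g /\ cancel g f.
Proof.
by case=> f [g fg gf]; exists f, (mklin (can2_linear fg gf)).
Qed.

Lemma isomorphic_can A B (f : {linear A -> B}) (g : {linear B -> A}) :
  cancel f g -> cancel g f -> isomorphic A B.
Proof. by move=> fg gf; exists f, g. Qed.

Lemma isomorphic_trans A B C :
  isomorphic A B -> isomorphic B C -> isomorphic A C.
Proof.
move=> [f bij_f] [g bij_g].
by exists (g \o f : {linear A -> C}); apply: bij_comp.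
Qed.

(** Such a [phi] sends strict inclusions to strict inclusions, hence strict chains to strict chains.
    The base rings may differ, so that submodules of a module can be compared with right ideals of
    its endomorphism ring. *)
Lemma height_le_transfer A (T : pzRingType) (B : lmodType T)
    (phi : submodClosed A -> submodClosed B) :
  (forall K L : submodClosed A, {subset L <= K} -> {subset phi L <= phi K}) ->
  (forall K L : submodClosed A, {subset L <= K} -> {subset phi K <= phi L} ->
     {subset K <= L}) ->
  forall n K, height_le n (phi K) -> height_le n K.
Proof.
move=> mono refl; elim=> [|n IH] K hK.
  have K0 : {subset K <= sub0}.
    apply: refl => [x /mksubP ->|x /hK ->]; exact: rpred0.
  by move=> x /K0 /mksubP.
move=> L LK KL; apply: IH; apply: hK; first exact: mono.
by move=> /(refl _ _ LK).
Qed.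

Lemma height_le_submod n M (K : submodClosed M) :
  height_le n K -> height_le n (subT : submodClosed (submod K)).
Proof.
move=> hK; apply: (@height_le_transfer _ _ _ (image_sub (incl K))).
- by move=> X L LX _ /mksubP[x /LX xX ->]; apply/mksubP; exists x.
- move=> X L LX XL x xX; have : val x \in image_sub (incl K) L.
    by apply: XL; apply/mksubP; exists x.
  by move=> /mksubP[y yL /val_inj ->].
- by apply: height_leW hK => _ /mksubP[x _ ->]; apply: submod_val_in.
Qed.

Lemma endo_sumE M (I : Type) (r : seq I) (P : pred I) (F : I -> endo M) x :
  (\sum_(i <- r | P i) F i : endo M) x = \sum_(i <- r | P i) F i x.
Proof. exact: (big_morph (fun f : endo M => f x) (fun _ _ => erefl) erefl). Qed.

(* Fitting's lemma: for n large, M is the direct sum of the image and of the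
   kernel of z = x^n, and y below is the inverse of z on the former. *)
Lemma height_strongly_pi_regular n M :
  height_le n (subT : submodClosed M) -> strongly_pi_regular (endo M).
Proof.
move=> hM x.
(* Images of powers of [x] descend and kernels ascend; both sequences stop. *)
have [i Di] : exists i, {subset image (x ^+ i : endo M)
    <= image (x ^+ i.+1 : endo M)}.
  apply: (@descending_stops _ _ n (fun i => image (x ^+ i : endo M))).
    by apply: height_leW hM => y _; apply/mksubP.
  by move=> i _ /mksubP[y ->]; apply/mksubP; exists (x y); rewrite exprSr.
have [j Dj] : exists j, {subset preimage (x ^+ j.+1 : endo M) sub0
    <= preimage (x ^+ j : endo M) sub0}.
  apply: (@ascending_stops _ _ n (fun i => preimage (x ^+ i : endo M) sub0) hM).
  move=> m y /mksubP /mksubP xy; apply/mksubP/mksubP.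
  by rewrite exprS -[LHS]/(x ((x ^+ m : endo M) y)) xy linear0.
have im k w : exists w', (x ^+ i : endo M) w = (x ^+ (k + i) : endo M) w'.
  elim: k w => [|k IH] w; first by exists w.
  have [w1 ->] := IH w.
  have /Di/mksubP[w2 w12] : (x ^+ i : endo M) w1 \in image (x ^+ i : endo M).
    by apply/mksubP; exists w1.
  exists w2; rewrite exprD -[LHS]/((x ^+ k : endo M) ((x ^+ i : endo M) w1)) w12.
  by rewrite addSnnS exprD.
have ker k w : (x ^+ (j + k) : endo M) w = 0 -> (x ^+ j : endo M) w = 0.
  elim: k => [|k IH]; first by rewrite addn0.
  rewrite addnS -addSn exprD => xw; apply: IH; rewrite exprD.
  have: (x ^+ k : endo M) w \in preimage (x ^+ j.+1 : endo M) sub0.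
    by apply/mksubP/mksubP.
  by move=> /Dj/mksubP/mksubP.
(* The exponent [(i + j).+1] is past both stopping indices. *)
exists (i + j)%N; set z : endo M := x ^+ _.
(* The cube allows the inverse to be defined by [z (g w)], an element of the image of [z], which
   [zinj] shows to be independent of the choice of [g w]; this gives linearity. *)
have zim w : exists w', z w = z (z (z w')).
  have [w' xw] := im ((i + j).+1 + (i + j).+1)%N w.
  exists w'; rewrite -[RHS]/((z * z * z) w') /z -!exprD.
  have -> : (i + j).+1 = (j.+1 + i)%N by rewrite addSn addnC.
  rewrite exprD -[LHS]/((x ^+ j.+1 : endo M) ((x ^+ i : endo M) w)) xw.
  rewrite -[LHS]/((x ^+ j.+1 * x ^+ _ : endo M) w') -exprD.
  by congr ((x ^+ _ : endo M) w'); lia.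
have zker w : z (z (z w)) = 0 -> z w = 0.
  rewrite -[LHS]/((z * z * z) w) /z -!exprD => xw.
  have -> : (i + j).+1 = (i.+1 + j)%N by rewrite addSn.
  rewrite exprD -[LHS]/((x ^+ i.+1 : endo M) ((x ^+ j : endo M) w)).
  rewrite (ker (i.+1 + (i + j).+1 + (i + j).+1)%N) ?linear0 // -[RHS]xw.
  by congr ((x ^+ _ : endo M) w); lia.
have zinj u v : z (z (z u)) = z (z (z v)) -> z u = z v.
  by move=> uv; apply/eqP; rewrite -subr_eq0 -linearB zker // !linearB uv subrr.
have [g zg] := choice zim.
have y_lin : linear (fun m => z (g m)).
  by move=> a u v; rewrite -linearP; apply: zinj; rewrite -zg !linearP -!zg.
pose y : endo M := mklin y_lin.
have zy : z * y = y * z.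
  apply: endo_ext => m; rewrite -[LHS]/(z (z (g m))) -[RHS]/(z (g (z m))).
  by apply: zinj; rewrite -zg -zg.
exists y; split=> //; apply: endo_ext => m.
by rewrite -mulrA -zy; rewrite -[LHS]/(z (z (z (g m)))) -zg.
Qed.

End LinearMaps.

(** * Finite direct sums and their injections and projections *)

Section DirectSums.
Local Open Scope ring_scope.
Variables (S : pzRingType) (I : finType).
Implicit Types (A B : I -> lmodType S) (M : lmodType S).

Fact dproj_linear A i : linear (fun x : dsum A => x i).
Proof. by move=> a x y; rewrite !ffunE. Qed.
Definition dproj A i : {linear dsum A -> A i} := mklin (dproj_linear i).

Fact dinj_linear A i :
  linear (fun x : A i => [ffun j => dfwith (fun j => 0 : A j) x j] : dsum A).
Proof.
move=> a x y; apply/ffunP => j; rewrite !ffunE.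
have [<-|ij] := eqVneq i j; first by rewrite !dfwith_in.
by rewrite !dfwith_out // scaler0 addr0.
Qed.
Definition dinj A i : {linear A i -> dsum A} := mklin (@dinj_linear A i).

Lemma dproj_dinj A i x : dproj A i (dinj A i x) = x.
Proof. by rewrite /= ffunE dfwith_in. Qed.

Lemma dproj_dinj0 A i j x : i != j -> dproj A j (dinj A i x) = 0.
Proof. by move=> ij; rewrite /= ffunE dfwith_out. Qed.

Lemma dsum_dproj A (x : dsum A) : x = \sum_i dinj A i (dproj A i x).
Proof.
apply/ffunP => j; rewrite -[RHS]/(dproj A j _) linear_sum (bigD1 j) //=.
rewrite big1 => [|i ij]; last exact: dproj_dinj0.
by rewrite addr0 ffunE dfwith_in.
Qed.

Lemma isomorphic_dsum A B :
  (forall i, isomorphic (A i) (B i)) -> isomorphic (dsum A) (dsum B).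
Proof.
move=> isoAB.
have fg i : {fg : {linear A i -> B i} * {linear B i -> A i} |
    cancel fg.1 fg.2 /\ cancel fg.2 fg.1}.
  by apply: cid; have [f [g [fK gK]]] := isomorphicP (isoAB i); exists (f, g).
pose f (x : dsum A) : dsum B := [ffun i => (sval (fg i)).1 (x i)].
pose g (x : dsum B) : dsum A := [ffun i => (sval (fg i)).2 (x i)].
have f_lin : linear f.
  by move=> a x y; apply/ffunP => i; rewrite !ffunE linearP.
exists (mklin f_lin), g => x; apply/ffunP => i; rewrite !ffunE.
  by case: (svalP (fg i)) => ->.
by case: (svalP (fg i)) => _ ->.
Qed.

(** A direct sum decomposition expressed by maps to and from [M], from which idempotents of [endo M]
    can be read off. *)
Definition biproduct M A (inj : forall i, {linear A i -> M})
    (prj : forall i, {linear M -> A i}) :=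
  [/\ forall i x, prj i (inj i x) = x,
      forall i j x, i != j -> prj j (inj i x) = 0
    & forall x, x = \sum_i inj i (prj i x)].

Lemma isomorphic_biproduct M A : isomorphic M (dsum A) ->
  exists (inj : forall i, {linear A i -> M}) (prj : forall i, {linear M -> A i}),
    biproduct inj prj.
Proof.
case/isomorphicP=> f [g [fg gf]].
exists (fun i => g \o dinj A i : {linear A i -> M}).
exists (fun i => dproj A i \o f : {linear M -> A i}).
split=> [i x|i j x ij|x].
- by rewrite -[LHS]/(dproj A i (f (g (dinj A i x)))) gf dproj_dinj.
- by rewrite -[LHS]/(dproj A j (f (g (dinj A i x)))) gf dproj_dinj0.
- by rewrite -{1}[x]fg {1}[f x]dsum_dproj linear_sum.
Qed.

Lemma biproduct_isomorphic M A (inj : forall i, {linear A i -> M})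
    (prj : forall i, {linear M -> A i}) :
  biproduct inj prj -> isomorphic M (dsum A).
Proof.
case=> prj_inj prj_inj0 sum_inj.
pose f x : dsum A := [ffun i => prj i x].
have f_lin : linear f by move=> a x y; apply/ffunP => i; rewrite !ffunE linearP.
exists (mklin f_lin), (fun x : dsum A => \sum_i inj i (x i)) => x.
  by rewrite [RHS]sum_inj; apply: eq_bigr => i _; rewrite ffunE.
apply/ffunP => i; rewrite ffunE linear_sum (bigD1 i) //= prj_inj.
by rewrite big1 ?addr0 // => j ji; apply: prj_inj0.
Qed.

(** Serves to present a summand as a power with exponent 1. *)
Lemma isomorphic_ffun1 (A : lmodType S) : isomorphic A {ffun 'I_1 -> A}.
Proof.
have f_lin : linear (fun x : A => [ffun=> x] : {ffun 'I_1 -> A}).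
  by move=> a x y; apply/ffunP => i; rewrite !ffunE.
exists (mklin f_lin), (fun g : {ffun 'I_1 -> A} => g ord0) => [x|g].
  by rewrite /= ffunE.
by apply/ffunP => i; rewrite ffunE (ord1 i).
Qed.

End DirectSums.

(** * Direct summands as idempotent endomorphisms *)

Section Retracts.
Local Open Scope ring_scope.
Variable S : pzRingType.
Implicit Types A B M : lmodType S.

Definition retract M A (inj : {linear A -> M}) (prj : {linear M -> A}) :
  endo M := inj \o prj.

Lemma retract_idem M A (inj : {linear A -> M}) (prj : {linear M -> A}) :
  cancel inj prj -> retract inj prj * retract inj prj = retract inj prj.
Proof. by move=> injK; apply: endo_ext => x; rewrite /= injK. Qed.

(** An idempotent [x] of the corner induces an idempotent [e] of [endo A], and [A] is the direct sum
    of the image and kernel of [e]. If the image vanishes, [x] is zero; if the kernel does, [x] is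
    the retraction idempotent. *)
Lemma retract_primitive M A (inj : {linear A -> M}) (prj : {linear M -> A}) :
  cancel inj prj -> indecomposable A -> primitive_idem (retract inj prj).
Proof.
move=> injK [[x0 x0N0] indec]; split; first exact: retract_idem.
  move=> r0; case/eqP: x0N0; rewrite -(injK x0) -[inj x0](congr1 inj (injK x0)).
  by rewrite -[inj (prj _)]/((retract inj prj : endo M) (inj x0)) r0 linear0.
move=> x xx ax xa.
have axv v : inj (prj (x v)) = x v by apply: (congr1 (fun f : endo M => f v) ax).
have xav v : x (inj (prj v)) = x v by apply: (congr1 (fun f : endo M => f v) xa).
have xxv v : x (x v) = x v by apply: (congr1 (fun f : endo M => f v) xx).
pose e : {linear A -> A} := prj \o x \o inj.
have ee v : e (e v) = e v by rewrite /= axv xxv.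
have [v|v|e0|e1] := indec (image e) (preimage e sub0).
- by move=> /mksubP[w ->] /mksubP/mksubP; rewrite ee.
- exists (e v), (v - e v); split; last by rewrite addrC subrK.
    by apply/mksubP; exists v.
  by apply/mksubP/mksubP; rewrite linearB ee subrr.
- left; apply: endo_ext => v; rewrite -xav -axv.
  suff -> : prj (x (inj (prj v))) = 0 by rewrite linear0.
  have : e (prj v) \in image e by apply/mksubP; exists (prj v).
  by rewrite e0 => /eqP.
- right; apply: endo_ext => v; rewrite -xav -axv /=.
  congr (inj _); apply/esym/eqP; rewrite -subr_eq0 -[_ == 0]/(_ \in pred1 0) -e1.
  by apply/mksubP/mksubP; rewrite linearB -[prj (x _)]/(e (prj v)) ee subrr.
Qed.

Lemma retract_isomorphic M A B (inj : {linear A -> M}) (prj : {linear M -> A})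
    (inj' : {linear B -> M}) (prj' : {linear M -> B}) :
  cancel inj prj -> cancel inj' prj' ->
  idem_iso (retract inj prj) (retract inj' prj') -> isomorphic A B.
Proof.
move=> injK injK' [u [v [uv vu]]].
have uvE x : u (v x) = inj (prj x).
  by rewrite -[LHS]/((u * v) x) uv.
have vuE x : v (u x) = inj' (prj' x).
  by rewrite -[LHS]/((v * u) x) vu.
apply: (@isomorphic_can _ _ _ (prj' \o v \o inj) (prj \o u \o inj')) => x /=.
  by rewrite -vuE !uvE !injK.
by rewrite -uvE !vuE !injK'.
Qed.

Lemma biproduct_complete M (I : finType) (A : I -> lmodType S)
    (inj : forall i, {linear A i -> M}) (prj : forall i, {linear M -> A i}) :
  biproduct inj prj -> complete_idem (fun i => retract (inj i) (prj i)).
Proof.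
case=> prj_inj prj_inj0 sum_inj; split=> [i|i j ij|].
- exact: retract_idem (prj_inj i).
- by apply: endo_ext => x; rewrite /= prj_inj0 ?linear0 // eq_sym.
- by apply: endo_ext => x; rewrite endo_sumE [RHS]sum_inj.
Qed.

(** Both decompositions become complete families of primitive idempotents of [endo M], and
    equivalent idempotents have isomorphic images. *)
Lemma krull_schmidt n M (p q : nat) (A : 'I_p -> lmodType S)
    (B : 'I_q -> lmodType S) :
  height_le n (subT : submodClosed M) ->
  (forall i, indecomposable (A i)) -> (forall j, indecomposable (B j)) ->
  isomorphic M (dsum A) -> isomorphic M (dsum B) ->
  exists s : 'I_p -> 'I_q,
    bijective s /\ forall i, isomorphic (A i) (B (s i)).
Proof.
move=> hM indA indB /isomorphic_biproduct[injA [prjA bA]].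
move=> /isomorphic_biproduct[injB [prjB bB]].
have [injAK _ _] := bA; have [injBK _ _] := bB.
have [s [bij_s iso_s]] := krull_schmidt_idem (height_strongly_pi_regular hM)
  (biproduct_complete bA) (fun i => retract_primitive (injAK i) (indA i))
  (biproduct_complete bB) (fun j => retract_primitive (injBK j) (indB j)).
by exists s; split=> // i; apply: (retract_isomorphic (injAK i) (injBK _)) (iso_s i).
Qed.

(** By induction on the height of the image: a nonzero [a] that is not primitive splits as
    [x + (a - x)] into orthogonal idempotents with strictly smaller images. *)
Lemma primitive_decomposition n M (a : endo M) :
  a * a = a -> height_le n (image a) ->
  exists (I : finType) (c : I -> endo M),
    [/\ forall i, primitive_idem (c i), forall i j, i != j -> c i * c j = 0,
        forall i, a * c i = c i /\ c i * a = c i & \sum_i c i = a].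
Proof.
elim: n a => [|n IH] a aa ha.
  exists void, (fun=> a); split=> [[]|[]|[]|].
  rewrite big_pred0; last by case.
  by apply: endo_ext => x; rewrite (ha (a x)) //; apply/mksubP; exists x.
have [a0|a0] := pselect (a = 0).
  exists void, (fun=> a); split=> [[]|[]|[]|].
  by rewrite big_pred0 ?a0 //; case.
have [pa|pa] := pselect (primitive_idem a).
  exists unit, (fun=> a); split=> //.
  by rewrite big_const card_unit /= addr0.
have [x [xx ax xa [x0 xNa]]] : exists x,
    [/\ x * x = x, a * x = x, x * a = x & x <> 0 /\ x <> a].
  apply: contrapT => nex; apply: pa; split=> // x xx ax xa.
  apply: contrapT => x0a; apply: nex; exists x; split=> //.
  by split=> h; apply: x0a; [left|right].
(* If the image of [a] were contained in that of [y], then [y] would fix it pointwise, so that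
   [y = y * a = a]. *)
have smaller y : y * y = y -> a * y = y -> y * a = y -> y <> a ->
    height_le n (image y).
  move=> yy ay ya yNa; apply: ha.
    move=> _ /mksubP[v ->]; apply/mksubP; exists (y v).
    by rewrite -[RHS]/((a * y) v) ay.
  move=> ima; apply: yNa; rewrite -ya; apply: endo_ext => v.
  have /ima/mksubP[w aw] : a v \in image a by apply/mksubP; exists v.
  by rewrite -[LHS]/(y (a v)) aw -[LHS]/((y * y) w) yy.
pose y := a - x.
have yy : y * y = y by rewrite mulrBl !mulrBr aa ax xa xx subrr subr0.
have ay : a * y = y by rewrite mulrBr aa ax.
have ya : y * a = y by rewrite mulrBl aa xa.
have xy : x * y = 0 by rewrite mulrBr xa xx subrr.
have yx : y * x = 0 by rewrite mulrBl ax xx subrr.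
have yNa : y <> a by move=> ya'; apply: x0; rewrite -(subKr a x) -/y ya' subrr.
have [I [c [pc oc xc sc]]] := IH x xx (smaller x xx ax xa xNa).
have [J [d [pd od yd sd]]] := IH y yy (smaller y yy ay ya yNa).
exists (I + J)%type, (fun k => match k with inl i => c i | inr j => d j end).
split.
- by case.
- move=> [i|i] [j|j] ij.
  + exact: oc.
  + by rewrite -(xc i).2 -(yd j).1 mulrA -(mulrA (c i)) xy mulr0 mul0r.
  + by rewrite -(yd i).2 -(xc j).1 mulrA -(mulrA (d i)) yx mulr0 mul0r.
  + exact: od.
- move=> [i|j]; split.
  + by rewrite -(xc i).1 mulrA ax.
  + by rewrite -(xc i).2 -mulrA xa.
  + by rewrite -(yd j).1 mulrA ay.
  + by rewrite -(yd j).2 -mulrA ya.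
- by rewrite big_sumType /= sc sd /y addrC subrK.
Qed.

End Retracts.

(** * Local modules as modules with a largest proper submodule *)

Section LocalModules.
Local Open Scope ring_scope.
Variable S : pzRingType.
Implicit Types A B M P : lmodType S.

Lemma local_moduleI M (N : submodClosed M) :
  ~ {subset predT <= N} ->
  (forall L : submodClosed M, ~ {subset predT <= L} -> {subset L <= N}) ->
  local_module M.
Proof.
move=> Nproper maxN.
have full (L : submodClosed M) : L =i predT <-> {subset predT <= L}.
  by split=> h x; [rewrite h | rewrite (h x isT)].
have maximalN : maximal_submod N.
  split=> // L NL _; have [/full eqL|/maxN LN] := pselect {subset predT <= L}.
    by right.
  by left=> x; apply/idP/idP=> [/LN|/NL].
exists N; split=> // [N' [_ N'proper maxN']|L /full nL]; last exact: maxN.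
case: (maxN' N (maxN N' N'proper)) => // eqN; last by case/full: Nproper.
by move=> x; rewrite eqN.
Qed.

Lemma local_moduleP M : local_module M ->
  exists N : submodClosed M, ~ {subset predT <= N} /\
    forall L : submodClosed M, ~ {subset predT <= L} -> {subset L <= N}.
Proof.
case=> N [[_ Nproper _] _ maxN]; exists N; split=> // L nL.
by apply: maxN => eqL; apply: nL => x; rewrite eqL.
Qed.

Lemma isomorphic_local_module A B :
  isomorphic A B -> local_module A -> local_module B.
Proof.
move=> /isomorphicP[f [g [fg gf]]] /local_moduleP[N [Nproper maxN]].
apply: (@local_moduleI _ (preimage g N)) => [h|L nL y yL].
  by apply: Nproper => x _; rewrite -(fg x); apply/(mksubP (preimage_subproof g N))/h.
apply/mksubP; apply: (maxN (preimage f L)) => [h|].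
  by apply: nL => z _; rewrite -(gf z); apply/(mksubP (preimage_subproof f L))/h.
by apply/mksubP; rewrite gf.
Qed.

End LocalModules.

(** * Unique maximal right ideal of a ring whose identity is a local idempotent *)

Section LocalRing.
Local Open Scope ring_scope.

(** The non-units form the largest proper right ideal. *)
Lemma local_idem1_ring (E : pzRingType) : local_idem (1 : E) -> local_ring E.
Proof.
move=> [_ n10 loc1].
have loc (x : E) : corner_unit 1 x \/ corner_unit 1 (1 - x).
  by apply: loc1; rewrite ?mul1r ?mulr1.
(* Here [r * x] is idempotent. If it is a unit, [x] also has a left inverse; if [1 - r * x] is one,
   then [r * x = 0] and [x = x * r * x = 0]. *)
have invr_unit (x r : E) : x * r = 1 -> corner_unit 1 x.
  move=> xr; have [[t [_ _ trx rxt]]|[t [_ _ trx _]]] := loc (r * x).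
    by apply: (@corner_unitLR _ _ _ (t * r) r); rewrite ?mul1r ?mulr1 // -mulrA.
  case: n10; rewrite -xr; suff -> : x = 0 by rewrite mul0r.
  have rxrx : (1 - r * x) * (r * x) = 0.
    by rewrite mulrBl mul1r -mulrA (mulrA x) xr mul1r subrr.
  have rx0 : r * x = 0 by rewrite -[r * x]mul1r -trx -mulrA rxrx mulr0.
  by rewrite -[x]mul1r -xr -mulrA rx0 mulr0.
have Nsub : submodP (fun x : rreg E => ~ corner_unit (1 : E) x).
  split=> [[t [_ _ t0 _]]|a x y xN yN [t [_ _ _ xyt]]].
    by apply: n10; rewrite -t0 mulr0.
  pose x' : E := x; pose y' : E := y; pose a' : E := a.
  (* [a *: x] is the product [x * a] of [E]. One of the two summands of 1 is a unit, making [x] or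
     [y] right invertible. *)
  have {}xyt : x' * (a' * t) + y' * t = 1 by rewrite -[RHS]xyt mulrDl -mulrA.
  case: (loc (x' * (a' * t))) => [[s [_ _ _ xs]]|[s [_ _ _ xs]]].
    by apply: xN; apply: (invr_unit _ (a' * t * s)); rewrite mulrA.
  apply: yN; apply: (invr_unit _ (t * s)); rewrite mulrA -[RHS]xs -xyt.
  by congr (_ * _); rewrite addrC addKr.
suff: local_module (rreg E) by case=> N [mN uN _]; exists N.
apply: (local_moduleI (N := mksub Nsub)) => [h|L nL x xL].
  have /mksubP := h 1 isT; apply; exists 1; split; exact: mulr1.
apply/mksubP => -[t [_ _ _ xt]]; apply: nL => y _.
pose x' : E := x; pose y' : E := y; pose r : E := t * y'.
have -> : y = (r : E^c) *: x.
  by rewrite -[RHS]/(x' * (t * y')) mulrA xt mul1r.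
exact: rpredZ.
Qed.

End LocalRing.

(** * Projective modules with local endomorphism rings *)

Section ProjectiveLocal.
Local Open Scope ring_scope.
Variable S : pzRingType.
Implicit Types A B M P : lmodType S.

(** [ext] identifies [endo A] with the corner of [endo M] at the retraction idempotent, and inverses
    are pulled back by [prj] and [inj]. *)
Lemma retract_local M A (inj : {linear A -> M}) (prj : {linear M -> A}) :
  cancel inj prj -> local_idem (retract inj prj) -> local_idem (1 : endo A).
Proof.
move=> injK [_ a0 loc]; split; first exact: mulr1.
  move=> id0; apply: a0; apply: endo_ext => x.
  by rewrite /= -[prj x]/((1 : endo A) (prj x)) id0 linear0.
pose ext (x : endo A) : endo M := inj \o x \o prj.
have lift (x : endo A) : corner_unit (retract inj prj) (ext x) ->
    corner_unit 1 x.
  case=> t [_ _ tx xt]; exists (prj \o t \o inj : endo A).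
  split; rewrite ?mul1r ?mulr1 //; apply: endo_ext => v.
    have := congr1 (fun f : endo M => prj (f (inj v))) tx.
    by rewrite /= !injK.
  have := congr1 (fun f : endo M => prj (f (inj v))) xt.
  by rewrite /= !injK.
move=> x _ _.
have [||h|h] := loc (ext x).
- by apply: endo_ext => v; rewrite /= injK.
- by apply: endo_ext => v; rewrite /= injK.
- by left; apply: lift.
- right; apply: lift; suff -> : ext (1 - x) = retract inj prj - ext x by [].
  by apply: endo_ext => v; rewrite /= linearB.
Qed.

Lemma retract_projective M A (inj : {linear A -> M}) (prj : {linear M -> A}) :
  cancel inj prj -> projective M -> projective A.
Proof.
move=> injK projM B C g h g_surj.
have [k gk] := projM B C g (h \o prj : {linear M -> C}) g_surj.
by exists (k \o inj : {linear A -> B}) => x; rewrite /= gk /= injK.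
Qed.

(* If L and N are proper submodules with L + N = P, the identity of P lifts
   along L * N -> P to a sum of two endomorphisms with images in L and N, and
   neither is invertible. *)
Lemma projective_local_module n P :
  projective P -> local_idem (1 : endo P) ->
  height_le n (subT : submodClosed P) -> local_module P.
Proof.
move=> projP [_ id0 loc] hP.
have [N [[_ Nproper maxN] _]] : exists N : submodClosed P,
    maximal_in subT N /\ height_le n N.
  apply: exists_maximal; first exact: height_leS.
  by move=> P0; apply: id0; apply: endo_ext => x; apply: P0; apply/mksubP.
apply: (@local_moduleI _ _ N) => [h|L nL x xL].
  by apply: Nproper => x _; apply: h.
apply: contrapT => xN.
have sumLN y : y \in subD L N.
  have [z zN|z _|eqN|->] := maxN (subD L N).
  - by apply/mksubP; exists 0, z; rewrite rpred0 add0r.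
  - exact/mksubP.
  - case: xN; rewrite -eqN; apply/mksubP; exists x, 0.
    by rewrite rpred0 addr0.
  - exact/mksubP.
have g_lin : linear (fun u : submod L * submod N => val u.1 + val u.2).
  by move=> a u v; rewrite /= scalerDr addrACA.
have [k gk] : exists k : {linear P -> (submod L * submod N)%type},
    forall y, mklin g_lin (k y) = y.
  apply: (projP _ _ (mklin g_lin) (idfun : {linear P -> P})) => y.
  have /mksubP[u [v [uL vN ->]]] := sumLN y.
  by exists (Submod uL, Submod vN).
have unit_full (K : submodClosed P) (f : endo P) :
    (forall y, f y \in K) -> corner_unit 1 f -> {subset predT <= K}.
  move=> fK [t [_ _ _ ft]] y _; suff -> : y = f (t y) by [].
  by rewrite -[RHS]/((f * t) y) ft.
have f_lin : linear (fun y => val (k y).1).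
  by move=> a u v; rewrite linearP.
pose f : endo P := mklin f_lin.
have [] := loc f; rewrite ?mul1r ?mulr1 //.
  by move/(unit_full L)=> h; apply: nL; apply: h => y; apply: submod_val_in.
move/(unit_full N)=> h; apply: Nproper => z _; apply: h => // y.
suff -> : (1 - f : endo P) y = val (k y).2 by apply: submod_val_in.
by rewrite -[LHS]/(y - val (k y).1) -{1}(gk y) /= addrC addKr.
Qed.

End ProjectiveLocal.

(** * Local projectives as principal right ideals, and consequences of faithful exactness *)

Section FaithfullyProjective.
Local Open Scope ring_scope.

(** An element [x] outside the largest proper submodule generates [P], so [phi] maps the regular
    module onto [P]. Projectivity splits [phi] by some [s], and [s] composed with [phi] is left
    multiplication by the idempotent [s x]. *)
Lemma local_projective_pright (R : pzRingType) (P : rmodType R) :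
  projective P -> local_module P ->
  exists e : R, local_idempotent e /\ isomorphic P (submod (pright e)).
Proof.
move=> projP locP; have [N [Nproper maxN]] := local_moduleP locP.
have [x xN] : exists x, x \notin N.
  apply: contrapT => nex; apply: Nproper => x _.
  by apply: contrapT => xN; apply: nex; exists x; apply/negP.
have phi_lin : linear (fun r : rreg R => (r : R^c) *: x).
  by move=> a r r'; rewrite scalerDl scalerA.
pose phi : {linear rreg R -> P} := mklin phi_lin.
have phi_surj y : exists r, phi r = y.
  suff: {subset predT <= image phi}.
    by move=> /(_ y isT)/mksubP[r ->]; exists r.
  apply: contrapT => /maxN phiN; case/negP: xN; apply: phiN.
  by apply/mksubP; exists (1 : R^c); rewrite /= scale1r.
have [s phis] := projP _ _ phi (idfun : {linear P -> P}) phi_surj.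
pose e : R := s x.
have sphi r : s (phi r) = e * r by rewrite /= linearZ.
have ee : e * e = e by rewrite -sphi phis.
have se y : s y \in pright e.
  by apply/asboolP; exists (s y); rewrite -sphi phis.
exists e; suff iso : isomorphic P (submod (pright e)).
  by split=> //; split=> //; apply: isomorphic_local_module iso locP.
apply: (@isomorphic_can _ _ _ (corestrict se)
  (phi \o incl (pright e) : {linear _ -> _})) => y.
  by rewrite -[LHS]/(phi (s y)) phis.
apply: val_inj; rewrite -[LHS]/(s (phi (val y))) sphi.
by have /asboolP[r ->] := submod_val_in y; rewrite mulrA ee.
Qed.

Variables (S : pzRingType) (M : lmodType S).
Hypothesis hM : faithfully_projective M.

(** Surjectivity of [g] is exactness at [B] with the zero map as second arrow. *)
Lemma faithfully_projective_projective : projective M.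
Proof.
move=> A B g h g_surj.
have ex : exact g (\0 : {linear B -> B}) by move=> b; split=> // _; apply: g_surj.
by have [k gk] := ((hM _ _).1 ex h).1 (fun _ => erefl); exists k.
Qed.

(** When maps from [M] into [K] all land in [L], the inclusion of [L] in [K] followed by the zero
    map is exact after Hom. Exactness is reflected, so the inclusion is onto. *)
Lemma faithfully_projective_hom_subset (K L : submodClosed M) :
  {subset L <= K} ->
  (forall f : endo M, (forall x, f x \in K) -> forall x, f x \in L) ->
  {subset K <= L}.
Proof.
move=> LK hom.
have inK (x : submod L) : val x \in K by apply/LK/submod_val_in.
pose f : {linear submod L -> submod K} := corestrict (f := incl L) inK.
suff /hM ex : Hom_exact M f (\0 : {linear submod K -> submod K}).
  move=> x xK; have [[y yf] _] := ((ex (Submod xK)).1 erefl, tt).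
  by rewrite -[x]/(val (Submod xK)) -yf; apply: (submod_val_in y).
move=> h; split=> // _.
have hL : forall x, incl K (h x) \in L.
  by apply: (hom (incl K \o h : endo M)) => x; apply: submod_val_in.
exists (corestrict (f := incl K \o h : {linear M -> M}) hL) => x.
exact: val_inj.
Qed.

Fact hom_subproof (K : submodClosed M) :
  submodP (fun f : rreg (endo M) => forall x, (f : endo M) x \in K).
Proof.
split=> [x|a f g fK gK x]; first exact: rpred0.
by rewrite -[X in X \in _]/((f : endo M) ((a : endo M) x) + (g : endo M) x) rpredD.
Qed.

(** Hom(M, K) as a right ideal of the endomorphism ring: precomposition with an endomorphism keeps
    values in [K]. *)
Definition hom_into (K : submodClosed M) : submodClosed (rreg (endo M)) :=
  mksub (hom_subproof K).

Lemma hom_intoP (K : submodClosed M) (f : rreg (endo M)) :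
  reflect (forall x, (f : endo M) x \in K) (f \in hom_into K).
Proof. exact: (mksubP (hom_subproof K) f). Qed.

Lemma faithfully_projective_height n :
  height_le n (subT : submodClosed (rreg (endo M))) ->
  height_le n (subT : submodClosed M).
Proof.
move=> hE; apply: (@height_le_transfer _ _ _ _ hom_into).
- by move=> K L LK f /hom_intoP fL; apply/hom_intoP => x; apply/LK.
- move=> K L LK KL; apply: faithfully_projective_hom_subset => // f fK.
  by have /hom_intoP : f \in hom_into L by apply: KL; apply/hom_intoP.
- by apply: height_leW hE => f _; apply/mksubP.
Qed.

(** If [M] were zero, Hom(M, -) would make every sequence exact, including the zero maps on the
    regular module, and 1 would be in the image of zero. *)
Lemma faithfully_projective_neq0 : (1 : S) <> 0 -> (1 : endo M) <> 0.
Proof.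
move=> n10 id0; apply: n10.
have ex : exact (\0 : {linear S^o -> S^o}) (\0 : {linear S^o -> S^o}).
  apply/hM => h; split=> // _; exists (\0 : {linear M -> S^o}) => x.
  have -> : x = 0 := congr1 (fun f : endo M => f x) id0.
  by rewrite (linear0 h).
by have [[y <-] _] := ((ex 1).1 erefl, tt).
Qed.

End FaithfullyProjective.

(** * The direct sum decomposition given by a complete family of idempotents *)

Section ImageFamilies.
Local Open Scope ring_scope.
Variables (S : pzRingType) (M : lmodType S).

Lemma image_in (a : endo M) x : a x \in image a.
Proof. by apply/mksubP; exists x. Qed.

Definition image_prj (a : endo M) : {linear M -> submod (image a)} :=
  corestrict (@image_in a).

Lemma image_retract (a : endo M) : retract (incl (image a)) (image_prj a) = a.
Proof. exact: endo_ext. Qed.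

Lemma image_inclK (a : endo M) :
  a * a = a -> cancel (incl (image a)) (image_prj a).
Proof.
move=> aa x; apply: val_inj; have /mksubP[y xy] := submod_val_in x.
by rewrite /= xy -[LHS]/((a * a) y) aa.
Qed.

Lemma image_biproduct (I : finType) (c : I -> endo M) : complete_idem c ->
  biproduct (fun i => incl (image (c i))) (fun i => image_prj (c i)).
Proof.
move=> [cc co c1]; split=> [i|i j x ij|x]; first exact: image_inclK.
  apply: val_inj; have /mksubP[y xy] := submod_val_in x.
  by rewrite /= xy -[LHS]/((c j * c i) y) co // eq_sym.
by rewrite -[LHS]/((1 : endo M) x) -c1 endo_sumE.
Qed.

End ImageFamilies.

Theorem theorem3p7 (R : nzRingType) (M : rmodType R)
    (hM : faithfully_projective M)
    (hE : finite_length (rreg (endo M))) :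
  [/\ finite_length M,
      exists (k : nat) (n : 'I_k -> nat)
             (Ms : 'I_k -> submodClosed M) (e : 'I_k -> R),
        [/\ (0 < k)%N /\ (forall i, 0 < n i)%N,
            forall i, [/\ local_module (submod (Ms i)),
                          projective (submod (Ms i))
                        & strongly_indecomposable (submod (Ms i))],
            isomorphic M
              (dsum (fun i : 'I_k => {ffun 'I_(n i) -> submod (Ms i)})),
            forall i, local_idempotent (e i)
          & isomorphic M
              (dsum (fun i : 'I_k => {ffun 'I_(n i) -> submod (pright (e i))}))]
    & forall (p q : nat) (A : 'I_p -> rmodType R) (B : 'I_q -> rmodType R),
        (forall i, indecomposable (A i)) ->
        (forall j, indecomposable (B j)) ->
        isomorphic M (dsum A) -> isomorphic M (dsum B) ->
        exists s : 'I_p -> 'I_q,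
          bijective s /\ forall i, isomorphic (A i) (B (s i))].
Proof.
have [n /(faithfully_projective_height hM) hT] := finite_length_height hE.
split; first exact: height_finite_length hT; last first.
  by move=> p q A B; apply: krull_schmidt hT.
have projM := faithfully_projective_projective hM.
have spr := height_strongly_pi_regular hT.
(* The identity idempotent, whose image is [M], is decomposed; the family is then reindexed by
   ordinals. *)
have [||I [c0 [prim0 orth0 _ sum0]]] :=
    @primitive_decomposition _ n M (1%R : endo M).
- exact: mulr1.
- by apply: height_leW hT => x _; apply/mksubP.
pose c (i : 'I_#|I|) := c0 (enum_val i).
have prim i : primitive_idem (c i) by apply: prim0.
have comp : complete_idem c.
  split=> [i|i j ij|]; first by case: (prim i).
    by apply: orth0; rewrite (inj_eq enum_val_inj).
  by rewrite -sum0 [in RHS]big_enum_val.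
pose P i := submod (image (c i)).
have cc i : (c i * c i)%R = c i by case: (prim i).
have locc i : local_idem (1%R : endo (P i)).
  apply: retract_local (image_inclK (cc i)) _.
  by rewrite image_retract; apply: primitive_idem_local.
have projP i : projective (P i) := retract_projective (image_inclK (cc i)) projM.
have locP i : local_module (P i).
  apply: (@projective_local_module _ n) => //; apply: height_le_submod.
  by apply: height_leW hT => x _; apply/mksubP.
have e i := cid (local_projective_pright (projP i) (locP i)).
have isoM : isomorphic M (dsum P).
  exact: biproduct_isomorphic (image_biproduct comp).
(* Isomorphic summands are not grouped: every multiplicity is 1. *)
exists #|I|, (fun=> 1), (fun i => image (c i)), (fun i => sval (e i)); split.
(* With no summands the identity of [endo M] would be an empty sum, hence zero. *)
- split=> //; rewrite lt0n; apply/eqP => I0.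
  apply: (faithfully_projective_neq0 hM); first exact/eqP/oner_neq0.
  by rewrite -sum0 big1 // => i; case: (fintype0 i I0).
- by move=> i; split; [apply: locP | apply: projP | exact: (local_idem1_ring (locc i))].
- apply: isomorphic_trans isoM _; apply: isomorphic_dsum => i.
  exact: isomorphic_ffun1.
- by move=> i; case: (svalP (e i)).
- apply: isomorphic_trans isoM _; apply: isomorphic_dsum => i.
  apply: isomorphic_trans (isomorphic_ffun1 _).
  by case: (svalP (e i)).
Qed.
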